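(* Let $X=(X_n)_{n\ge 0}$ be a Markov chain with values in a finite set $\mathbb{S}=\{a_1,\dots,a_d\}\subset\mathbb{R}$, with transition matrix $\Lambda=(\lambda_{ij})$, $\lambda_{ij}=\mathrm{P}(X_n=a_j\mid X_{n-1}=a_i)$, and initial distribution $\nu$. Let $h:\mathbb{S}\to\mathbb{R}$ be a function, let $\xi=(\xi_n)_{n\ge1}$ be a sequence of i.i.d. real random variables independent of $X$, and for $\sigma>0$ let $$Y^\sigma_n=h(X_n)+\sigma\xi_n,\qquad n\ge 1 .$$ Assume that the law of $\xi_1$ has a bounded twice continuously differentiable density $g$ with respect to the Lebesgue measure on $\mathbb{R}$, with bounded continuous derivatives $g',g''$. Let $\pi^\sigma_n$ be the solution of the filtering equation $$\pi^\sigma_n=\frac{G^\sigma(Y^\sigma_n)\Lambda^*\pi^\sigma_{n-1}}{\big|G^\sigma(Y^\sigma_n)\Lambda^*\pi^\sigma_{n-1}\big|},\quad n\ge1,\qquad \pi^\sigma_0=\nu,$$ where $G^\sigma(y)$ is the diagonal matrix with diagonal entries $g\big((y-h(a_i))/\sigma\big)$, $i=1,\dots,d$. Put $\nu_n=(\Lambda^* )^n\nu$. Then for every $n\ge 0$, $\mathrm{P}$-almost surely, $\pi^\sigma_n\to\nu_n$ as $\sigma\to\infty$ and $$\sigma\big(\pi^\sigma_n-\nu_n\big)\longrightarrow Z_n\quad\text{as }\sigma\to\infty,$$ where $Z_n$ satisfies $$Z_n=\Lambda^*Z_{n-1}-\big(\mathrm{diag}(\nu_n)-\nu_n\nu_n^*\big)h\,\frac{g'(\xi_n)}{g(\xi_n)},\quad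 n\ge 1,\qquad Z_0=0 .$$
   Context: All random variables are defined on one complete probability space $(\Omega,\mathcal{F},\mathrm{P})$; the same $X$ and $\xi$ are used for all $\sigma$. Probability measures on $\mathbb{S}$ are identified with (column) vectors in the simplex $\mathcal{S}^{d-1}=\{x\in\mathbb{R}^d:x_i\ge0,\ \sum_i x_i=1\}$, and functions on $\mathbb{S}$ with column vectors in $\mathbb{R}^d$; in particular $h$ also denotes the column vector with entries $h(a_i)$. The superscript $*$ denotes transposition, $|x|=\sum_{i=1}^d|x_i|$ is the $\ell_1$-norm, and $\mathrm{diag}(x)$ is the diagonal matrix with diagonal entries $x_i$. For fixed $\sigma$, $\pi^\sigma_n(i)=\mathrm{P}(X_n=a_i\mid Y^\sigma_1,\dots,Y^\sigma_n)$ almost surely, and the denominator in the filtering equation is almost surely positive. *)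

(* Defs.v *)
From HB Require Import structures.
From mathcomp Require Import all_boot all_order all_algebra.
From mathcomp Require Import all_classical all_reals all_analysis.

Set Implicit Arguments.
Unset Strict Implicit.
Unset Printing Implicit Defensive.

Import Order.TTheory GRing.Theory Num.Theory.
Import numFieldNormedType.Exports.

Local Open Scope classical_set_scope.
Local Open Scope ring_scope.

Definition in_simplex (R : realType) (d : nat) (x : 'cV[R]_d) : Prop :=
  (forall i, 0 <= x i 0) /\ \sum_(i < d) x i 0 = 1.

Definition stochastic (R : realType) (d : nat) (Lam : 'M[R]_d) : Prop :=
  forall i, in_simplex (row i Lam)^T.

Definition l1norm (R : realType) (d : nat) (x : 'cV[R]_d) : R :=
  \sum_(i < d) `|x i 0|.

(* P(A | B); only meaningful when P B > 0 *)
Definition cond_prob (R : realType) (disp : measure_display)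
    (Omega : measurableType disp) (P : probability Omega R)
    (A B : set Omega) : R :=
  fine (P (A `&` B)) / fine (P B).

(* The state space is {a 0, ..., a (d-1)}. Conditional probabilities are
   constrained only when the conditioning event has positive probability;
   [stochastic] constrains the rows of Lam at states that are never visited. *)
Record markov_chain (R : realType) (disp : measure_display)
    (Omega : measurableType disp) (P : probability Omega R) (d : nat)
    (a : 'I_d -> R) (Lam : 'M[R]_d) (nu : 'cV[R]_d)
    (X : nat -> {RV P >-> R}) : Prop := MarkovChain {
  mc_states : injective a ;
  mc_values : forall n w, exists i, X n w = a i ;
  mc_stochastic : stochastic Lam ;
  mc_simplex : in_simplex nu ;
  mc_initial : forall i, P [set w | X 0%N w = a i] = (nu i 0)%:E ;
  mc_transition : forall n i j, (0 < P [set w | X n w = a i])%E ->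
    cond_prob P [set w | X n.+1 w = a j] [set w | X n w = a i] = Lam i j ;
  mc_markov : forall n (s : nat -> 'I_d),
    let past := \bigcap_(k in `I_n.+1) [set w | X k w = a (s k)] in
    (0 < P past)%E ->
    cond_prob P [set w | X n.+1 w = a (s n.+1)] past =
    cond_prob P [set w | X n.+1 w = a (s n.+1)] [set w | X n w = a (s n)]
}.

(* the sigma-algebra generated by (X_n), n in I *)
Definition process_sigma (R : realType) (disp : measure_display)
    (Omega : measurableType disp) (P : probability Omega R) (I : set nat)
    (X : nat -> {RV P >-> R}) : set (set Omega) :=
  <<s \bigcup_(n in I) preimage_set_system setT (X n) measurable >>.

Definition independent_processes (R : realType) (disp : measure_display)
    (Omega : measurableType disp) (P : probability Omega R) (I J : set nat)
    (X xi : nat -> {RV P >-> R}) : Prop :=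
  forall A B, process_sigma I X A -> process_sigma J xi B ->
  P (A `&` B) = (P A * P B)%E.

Definition mutually_independent (R : realType) (disp : measure_display)
    (Omega : measurableType disp) (P : probability Omega R) (I : set nat)
    (xi : nat -> {RV P >-> R}) : Prop :=
  forall (s : seq nat) (B : nat -> set R), uniq s -> [set` s] `<=` I ->
  (forall n, measurable (B n)) ->
  P (\bigcap_(n in [set` s]) (xi n @^-1` B n)) =
  (\prod_(n <- s) P (xi n @^-1` B n))%E.

Definition identically_distributed (R : realType) (disp : measure_display)
    (Omega : measurableType disp) (P : probability Omega R) (I : set nat)
    (xi : nat -> {RV P >-> R}) : Prop :=
  forall m n, I m -> I n -> forall B : set R, measurable B ->
  distribution P (xi m) B = distribution P (xi n) B.

Definition has_density (R : realType) (disp : measure_display)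
    (Omega : measurableType disp) (P : probability Omega R)
    (xi : {RV P >-> R}) (g : R -> R) : Prop :=
  (forall x, 0 <= g x) /\
  forall B : set R, measurable B ->
  distribution P xi B = (\int[lebesgue_measure]_(x in B) (g x)%:E)%E.

(* g is C^2, and g, g', g'' are bounded *)
Record C2_bounded (R : realType) (g : R -> R) : Prop := C2Bounded {
  C2_derivable1 : forall x, derivable g x 1 ;
  C2_derivable2 : forall x, derivable g^`()%classic x 1 ;
  C2_continuous1 : continuous g^`()%classic ;
  C2_continuous2 : continuous g^`(2)%classic ;
  C2_bounded0 : bounded_fun g ;
  C2_bounded1 : bounded_fun g^`()%classic ;
  C2_bounded2 : bounded_fun g^`(2)%classic
}.

(* the vector (h(a_i))_i; h is given on all of R, only its values on the
   state space matter *)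
Definition hvec (R : realType) (d : nat) (a : 'I_d -> R) (h : R -> R) :
  'cV[R]_d := \col_i h (a i).

Definition observation (R : realType) (disp : measure_display)
    (Omega : measurableType disp) (P : probability Omega R) (h : R -> R)
    (X xi : nat -> {RV P >-> R}) (sigma : R) (n : nat) (w : Omega) : R :=
  h (X n w) + sigma * xi n w.

Definition likelihood (R : realType) (d : nat) (a : 'I_d -> R) (h g : R -> R)
    (sigma y : R) : 'M[R]_d :=
  diag_mx (\row_i g ((y - h (a i)) / sigma)).

(* The filtering equation along the observation path y. Nothing is required
   of [rho n.+1] when the denominator vanishes, which for given sigma happens
   only on a null set of observation paths. *)
Definition filtering_solution (R : realType) (d : nat) (a : 'I_d -> R)
    (h g : R -> R) (Lam : 'M[R]_d) (nu : 'cV[R]_d) (sigma : R) (y : nat -> R)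
    (rho : nat -> 'cV[R]_d) : Prop :=
  rho 0%N = nu /\
  forall n, let v := likelihood a h g sigma (y n.+1) *m (Lam^T *m rho n) in
  l1norm v != 0 -> rho n.+1 = (l1norm v)^-1 *: v.

Definition nu_seq (R : realType) (d : nat) (Lam : 'M[R]_d) (nu : 'cV[R]_d)
    (n : nat) : 'cV[R]_d :=
  Lam^T ^+ n *m nu.

(* The linear recursion driven by the noise path x; the quotient is a genuine
   one unless g (x n.+1) = 0, which has probability zero when x n.+1 is
   distributed with density g. *)
Fixpoint Z_seq (R : realType) (d : nat) (a : 'I_d -> R) (h g : R -> R)
    (Lam : 'M[R]_d) (nu : 'cV[R]_d) (x : nat -> R) (n : nat) : 'cV[R]_d :=
  if n is m.+1 then
    Lam^T *m Z_seq a h g Lam nu x m -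
    (g^`()%classic (x n) / g (x n)) *:
      ((diag_mx (nu_seq Lam nu n)^T - nu_seq Lam nu n *m (nu_seq Lam nu n)^T)
         *m hvec a h)
  else 0.

(* Main.v *)
(* Almost surely g(xi_k) != 0 for all k >= 1; fix such an outcome and argue by
   induction on n. The prediction p = Lam^* pi_(n-1) satisfies
   sigma (p - nu_n) -> Lam^* Z_(n-1), and since
   (Y_n - h(a_i)) / sigma = xi_n + (h(X_n) - h(a_i)) / sigma, the likelihoods
   satisfy sigma (G_i - g(xi_n)) -> (h(X_n) - h(a_i)) g'(xi_n). Expanding
   G_i p_i / (sum_k G_k p_k) to first order gives the limit; the unknown value
   h(X_n) is common to all the states and disappears in the normalization. *)
Require Import Defs.
From mathcomp Require Import all_boot all_order all_algebra.
From mathcomp Require Import all_classical all_reals all_analysis.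
From mathcomp Require Import ring.

Set Implicit Arguments.
Unset Strict Implicit.
Unset Printing Implicit Defensive.

Import Order.TTheory GRing.Theory Num.Theory.
Import numFieldNormedType.Exports.

Local Open Scope classical_set_scope.
Local Open Scope ring_scope.

(** * Limits at infinity, entrywise and to first order *)

Lemma cvg_mx_coord (m n : nat) (T : topologicalType) (I : Type)
    (F : set_system I) {FF : Filter F} (f : I -> 'M[T]_(m, n))
    (M : 'M[T]_(m, n)) :
  (forall i j, f x i j @[x --> F] --> M i j) -> f x @[x --> F] --> M.
Proof.
move=> fM A [B MB BA]; rewrite /nbhs /=.
have FB : \forall x \near F, forall ij : 'I_m * 'I_n,
    B ij.1 ij.2 (f x ij.1 ij.2).
  by apply: filter_forall => ij; exact: fM (MB _ _).
by apply: filterS FB => x Bx; apply: BA => i j; exact: Bx (i, j).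
Qed.

Lemma cvg_coord_mx (K : numFieldType) (m n : nat) (I : Type)
    (F : set_system I) {FF : Filter F} (f : I -> 'M[K]_(m, n))
    (M : 'M[K]_(m, n)) i j :
  f x @[x --> F] --> M -> f x i j @[x --> F] --> M i j.
Proof.
by move=> fM A MA; apply: (fM [set N | A (N i j)]); exact: coord_continuous.
Qed.

Lemma cvg_inv_pinfty (R : realType) : x^-1 @[x --> +oo] --> (0 : R).
Proof. by apply/gtr0_cvgV0; [exact: nbhs_pinfty_gt | exact: cvg_id]. Qed.

(** For [x > 0] the error [f x - l] is [x^-1] times a convergent quantity. Hence first-order limits
    already contain the zeroth-order ones, and only the former have to be carried along. *)
Lemma cvg_scaled (R : realType) (f : R -> R) (l L : R) :
  x * (f x - l) @[x --> +oo] --> L -> f x @[x --> +oo] --> l.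
Proof.
move=> fL.
have : x^-1 * (x * (f x - l)) + l @[x --> +oo] --> 0 * L + l.
  by apply: cvgD; [apply: cvgM => //; exact: cvg_inv_pinfty | exact: cvg_cst].
rewrite mul0r add0r; apply: cvg_trans; apply: near_eq_cvg.
have : \forall x \near +oo, (0 : R) < x by exact: nbhs_pinfty_gt.
by apply: filterS => x x0; rewrite mulKf ?subrK// gt_eqF.
Qed.

Lemma cvg_scaled_increment (R : realType) (g : R -> R) (x c : R) :
  derivable g x 1 ->
  s * (g (x + c / s) - g x) @[s --> +oo] --> c * g^`()%classic x.
Proof.
(* The derivative is a limit along the punctured filter [0^']. The increment [c / s] stays in it
   only if [c] is nonzero, so [c = 0] is treated apart. *)
move=> gx; have [->|c0] := eqVneq c 0.
  under eq_fun do rewrite mul0r addr0 subrr mulr0.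
  by rewrite mul0r; exact: cvg_cst.
have spos : \forall s \near +oo, (0 : R) < s by exact: nbhs_pinfty_gt.
have h0 : c / s @[s --> +oo] --> 0^'.
  have cs0 : c / s @[s --> +oo] --> (0 : R).
    rewrite -(mulr0 c).
    by apply: cvgM; [exact: cvg_cst | exact: cvg_inv_pinfty].
  move=> A /cs0; apply: filterS2 spos => s s0; apply.
  by rewrite mulf_neq0// invr_neq0// gt_eqF.
have gD : h^-1 *: ((g \o shift x) (h *: 1) - g x) @[h --> 0^'] -->
    g^`()%classic x.
  by rewrite derive1E; exact: gx.
have lim : c * ((c / s)^-1 *: ((g \o shift x) ((c / s) *: 1) - g x))
    @[s --> +oo] --> c * g^`()%classic x.
  by apply: cvgM; [exact: cvg_cst | exact: (cvg_comp _ _ h0 gD)].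
apply: cvg_trans lim; apply: near_eq_cvg; apply: filterS spos => s s0.
rewrite /= /GRing.scale /= mulr1 [c / s + x]addrC invf_div mulrA mulrCA.
by rewrite mulfV// mulr1.
Qed.

Lemma cvg_scaled_coord (R : realType) (m n : nat) (f : R -> 'M[R]_(m, n))
    (M L : 'M[R]_(m, n)) (i : 'I_m) (j : 'I_n) :
  x *: (f x - M) @[x --> +oo] --> L ->
  x * (f x i j - M i j) @[x --> +oo] --> L i j.
Proof.
move=> fL.
have : (x *: (f x - M)) i j @[x --> +oo] --> L i j by exact: cvg_coord_mx fL.
by under eq_fun do rewrite !mxE.
Qed.

Lemma cvg_scaled_mx (R : realType) (m n : nat) (f : R -> 'M[R]_(m, n))
    (M L : 'M[R]_(m, n)) :
  x *: (f x - M) @[x --> +oo] --> L -> f x @[x --> +oo] --> M.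
Proof.
move=> fL; apply: cvg_mx_coord => i j.
exact: (cvg_scaled (cvg_scaled_coord (i := i) (j := j) fL)).
Qed.

(** One Bayes update to first order: [p] is the prediction with limit [q], and [G] holds likelihoods
    that all tend to the same [c]. To leading order the observation is thus uninformative, and [q]
    is left unchanged by the update. *)
Lemma cvg_renormalized (R : realType) (d : nat) (p : R -> 'cV[R]_d)
    (q z : 'cV[R]_d) (G : R -> 'I_d -> R) (c : R) (D : 'I_d -> R) :
  c != 0 -> (\forall s \near +oo, \sum_i p s i 0 = 1) ->
  s *: (p s - q) @[s --> +oo] --> z ->
  (forall i, s * (G s i - c) @[s --> +oo] --> D i) ->
  (\forall s \near +oo, \sum_k G s k * p s k 0 != 0) /\
  s *: ((\sum_k G s k * p s k 0)^-1 *: (\col_i (G s i * p s i 0)) - q)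
    @[s --> +oo] -->
  z + c^-1 *: \col_i (q i 0 * (D i - \sum_k D k * q k 0)).
Proof.
move=> c0 p1 pz GD.
have zE i := cvg_scaled_coord (i := i) (j := 0) pz.
have pq i := cvg_scaled (zE i).
have Gc i : G s i @[s --> +oo] --> c by exact: cvg_scaled (GD i).
(* Total mass passes to the limit; this makes the normalizer tend to [c]. *)
have q1 : \sum_i q i 0 = 1.
  have sq : \sum_i p s i 0 @[s --> +oo] --> \sum_i q i 0.
    by apply: cvg_big => //; exact: add_continuous.
  have s1 : \sum_i p s i 0 @[s --> +oo] --> (1 : R).
    by apply: (cvg_trans (near_eq_cvg _)) (cvg_cst _); apply: filterS p1.
  exact: cvg_unique sq s1.
have Sc : \sum_k G s k * p s k 0 @[s --> +oo] --> c.
  rewrite -[X in _ --> X]mulr1 -q1 mulr_sumr.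
  by apply: cvg_big => [|i _]; [exact: add_continuous | exact: cvgM].
have S0 : \forall s \near +oo, \sum_k G s k * p s k 0 != 0.
  exact: cvgr_neq0 Sc c0.
split=> //; apply: cvg_mx_coord => i j; rewrite {j}ord1 !mxE.
(* Writing S for the normalizer, the numerator equals [s * (G s i * p s i 0 - q i 0 * S)] exactly,
   because [p s] has mass 1. There is no remainder to estimate, and each term converges. *)
have lim : (s * (G s i - c) * p s i 0
    - q i 0 * (\sum_k s * (G s k - c) * p s k 0)
    + c * (s * (p s i 0 - q i 0))) / (\sum_k G s k * p s k 0)
    @[s --> +oo] -->
    (D i * q i 0 - q i 0 * (\sum_k D k * q k 0) + c * z i 0) / c.
  apply: cvgM; last exact: cvgV.
  apply: cvgD; last by apply: cvgM => //; exact: cvg_cst.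
  apply: cvgB; first exact: cvgM.
  apply: cvgM; first exact: cvg_cst.
  by apply: cvg_big => [|k _]; [exact: add_continuous | exact: cvgM].
have -> : z i 0 + c^-1 * (q i 0 * (D i - \sum_k D k * q k 0)) =
    (D i * q i 0 - q i 0 * (\sum_k D k * q k 0) + c * z i 0) / c by field.
apply: cvg_trans lim; apply: near_eq_cvg.
near=> s; rewrite !mxE.
have -> : \sum_k s * (G s k - c) * p s k 0 =
    s * ((\sum_k G s k * p s k 0) - c).
  rewrite -[X in _ * (_ - X)]mulr1.
  have <- : \sum_k p s k 0 = 1 by near: s.
  by rewrite mulr_sumr -sumrB mulr_sumr; apply: eq_bigr => k _; ring.
have : \sum_k G s k * p s k 0 != 0 by near: s.
by move: (\sum_k _) => S S0'; field.
Unshelve. all: by end_near. Qed.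

(** * Induction along one fixed outcome *)

Lemma simplex_stochastic (R : realType) (d : nat) (Lam : 'M[R]_d)
    (x : 'cV[R]_d) :
  stochastic Lam -> in_simplex x -> in_simplex (Lam^T *m x).
Proof.
move=> stL [x0 x1]; split=> [i|].
  rewrite mxE; apply: sumr_ge0 => k _; rewrite mxE mulr_ge0//.
  by have [/(_ i)] := stL k; rewrite !mxE.
under eq_bigr do rewrite mxE.
rewrite exchange_big/= -x1; apply: eq_bigr => k _; rewrite -mulr_suml.
have [_] := stL k; under eq_bigr do rewrite !mxE.
by move=> Lk; under eq_bigr do rewrite mxE; rewrite Lk mul1r.
Qed.

Lemma nu_seqS (R : realType) (d : nat) (Lam : 'M[R]_d) (nu : 'cV[R]_d) n :
  nu_seq Lam nu n.+1 = Lam^T *m nu_seq Lam nu n.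
Proof. by rewrite /nu_seq exprS mulmxA. Qed.

Lemma nu_seq_simplex (R : realType) (d : nat) (Lam : 'M[R]_d) (nu : 'cV[R]_d)
    n : stochastic Lam -> in_simplex nu -> in_simplex (nu_seq Lam nu n).
Proof.
move=> stL nuS; elim: n => [|n IH]; first by rewrite /nu_seq expr0 mul1mx.
by rewrite nu_seqS; exact: simplex_stochastic.
Qed.

(* H stands for a path of the hidden signal h(X) and x for one of the noise;
   membership in the simplex is part of the induction because it identifies the
   l1-norm in the filtering equation with a sum. *)
Lemma filter_expansion (R : realType) (d : nat) (a : 'I_d -> R) (h g : R -> R)
    (Lam : 'M[R]_d) (nu : 'cV[R]_d) (H x : nat -> R)
    (rho : R -> nat -> 'cV[R]_d) :
  stochastic Lam -> in_simplex nu -> (forall t, 0 <= g t) ->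
  (forall t, derivable g t 1) -> (forall n, g (x n.+1) != 0) ->
  (forall s, 0 < s -> filtering_solution a h g Lam nu s
     (fun n => H n + s * x n) (rho s)) ->
  forall n, (\forall s \near +oo, in_simplex (rho s n)) /\
    s *: (rho s n - nu_seq Lam nu n) @[s --> +oo] --> Z_seq a h g Lam nu x n.
Proof.
move=> stL nuS g0 dg gx sol; elim=> [|n [rhoS IH]].
  have r0 : \forall s \near +oo, rho s 0%N = nu.
    apply: filterS (nbhs_pinfty_gt (num_real (0 : R))) => s s0.
    by have [] := sol s s0.
  split; first by apply: filterS r0 => s ->.
  apply: (cvg_trans (near_eq_cvg _)) (cvg_cst _).
  by apply: filterS r0 => s /= ->; rewrite /nu_seq expr0 mul1mx subrr scaler0.
pose G s i := g (x n.+1 + (H n.+1 - h (a i)) / s).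
pose p s := Lam^T *m rho s n.
have spos : \forall s \near +oo, (0 : R) < s by exact: nbhs_pinfty_gt.
have pS : \forall s \near +oo, in_simplex (p s).
  by apply: filterS rhoS => s; exact: simplex_stochastic.
have p1 : \forall s \near +oo, \sum_i p s i 0 = 1.
  by apply: filterS pS => s [].
have pz : s *: (p s - nu_seq Lam nu n.+1) @[s --> +oo] -->
    Lam^T *m Z_seq a h g Lam nu x n.
  apply: cvg_mx_coord => i j; rewrite [X in _ --> X]mxE.
  have : \sum_k Lam^T i k * (s *: (rho s n - nu_seq Lam nu n)) k j
      @[s --> +oo] --> \sum_k Lam^T i k * Z_seq a h g Lam nu x n k j.
    apply: cvg_big => [|k _]; first exact: add_continuous.
    by apply: cvgM; [exact: cvg_cst | exact: cvg_coord_mx].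
  apply: cvg_trans; apply: near_eq_cvg; near=> s.
  by rewrite nu_seqS /p -mulmxBr scalemxAr mxE.
have GD i : s * (G s i - g (x n.+1)) @[s --> +oo] -->
    (H n.+1 - h (a i)) * g^`()%classic (x n.+1).
  exact: cvg_scaled_increment.
have [S0 lim] := cvg_renormalized (gx n) p1 pz GD.
(* The filtering equation determines [rho s n.+1] only when its denominator is nonzero. This holds
   for large [s], since the denominator tends to [g (x n.+1)]. *)
have rhoE : \forall s \near +oo, in_simplex (rho s n.+1) /\
    rho s n.+1 = (\sum_k G s k * p s k 0)^-1 *: (\col_i (G s i * p s i 0)).
  near=> s.
  have s0 : 0 < s by near: s.
  have [ps0 _] : in_simplex (p s) by near: s.
  have Gp0 i : 0 <= G s i * p s i 0.
    by apply: mulr_ge0; [exact: g0 | exact: ps0].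
  have Ss0 : \sum_k G s k * p s k 0 != 0 by near: s.
  have [_ /(_ n) /=] := sol s s0.
  have -> : likelihood a h g s (H n.+1 + s * x n.+1) *m (Lam^T *m rho s n) =
      \col_i (G s i * p s i 0).
    apply/colP => i; rewrite mul_diag_mx !mxE; congr (g _ * _).
    by field; rewrite gt_eqF.
  have -> : l1norm (\col_i (G s i * p s i 0)) = \sum_k G s k * p s k 0.
    by rewrite /l1norm; apply: eq_bigr => i _; rewrite mxE ger0_norm.
  move=> /(_ Ss0) ->; split=> //; split=> [i|].
    by rewrite 2!mxE; apply: mulr_ge0 => //; rewrite invr_ge0; exact: sumr_ge0.
  under eq_bigr do rewrite 2!mxE.
  by rewrite -mulr_sumr mulVf.
split; first by apply: filterS rhoE => s [].
set Z := (X in _ --> X).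
have -> : Z = Lam^T *m Z_seq a h g Lam nu x n + (g (x n.+1))^-1 *:
    \col_i (nu_seq Lam nu n.+1 i 0 *
      ((H n.+1 - h (a i)) * g^`()%classic (x n.+1) -
       \sum_k (H n.+1 - h (a k)) * g^`()%classic (x n.+1) *
          nu_seq Lam nu n.+1 k 0)).
  rewrite /Z /=; congr (_ + _); apply/colP => i.
  have [_ q1] := nu_seq_simplex n.+1 stL nuS.
  rewrite mulmxBl -mulmxA mul_diag_mx.
  set q := nu_seq Lam nu n.+1 in q1 *.
  rewrite !mxE big_ord1 !mxE.
  (* As [q] has mass 1, [H n.+1] comes out of the average unweighted and cancels against the one in
     the [i]-th correction. What remains is the mean of [h] under [q] minus [h (a i)]. *)
  have -> : \sum_k (H n.+1 - h (a k)) * g^`()%classic (x n.+1) * q k 0 =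
     (H n.+1 - \sum_k q^T 0 k * hvec a h k 0) * g^`()%classic (x n.+1).
    rewrite -[H n.+1 in RHS]mulr1 -q1 mulr_sumr -sumrB mulr_suml.
    by apply: eq_bigr => k _; rewrite !mxE; ring.
  by move: (\sum_k _) => u; field; exact: gx.
apply: cvg_trans lim; apply: near_eq_cvg.
by apply: filterS rhoE => s /= [_ ->].
Unshelve. all: by end_near. Qed.

(** * The exceptional null set *)

Lemma ae_density_neq0 (R : realType) (disp : measure_display)
    (Omega : measurableType disp) (P : probability Omega R)
    (X Y : {RV P >-> R}) (g : R -> R) :
  measurable_fun setT g -> has_density X g ->
  (forall B, measurable B -> distribution P Y B = distribution P X B) ->
  {ae P, forall w, g (Y w) != 0}.
Proof.
move=> mg [_ Xg] YX.
have mB : measurable (g @^-1` [set 0]).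
  by rewrite -[_ @^-1` _]setTI; exact: mg.
exists (Y @^-1` (g @^-1` [set 0])); split.
- by rewrite -[_ @^-1` _]setTI; exact: measurable_funP.
(* The law of [X] gives the zero set of [g] the integral of [g] over it, which is 0; equality of
   laws carries this to [Y]. *)
- have := YX _ mB; rewrite Xg// integral0_eq; first by [].
  by move=> t /= ->.
- by move=> w /= /negP; rewrite negbK => /eqP.
Qed.

Theorem theorem2p1 (R : realType) (disp : measure_display)
    (Omega : measurableType disp) (P : probability Omega R)
    (hP : measure_is_complete P)
    (d : nat) (a : 'I_d -> R) (Lam : 'M[R]_d) (nu : 'cV[R]_d)
    (X : nat -> {RV P >-> R}) (hX : markov_chain a Lam nu X)
    (h : R -> R)
    (xi : nat -> {RV P >-> R})
    (hxi_indep : mutually_independent [set n : nat | (0 < n)%N] xi)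
    (hxi_id : identically_distributed [set n : nat | (0 < n)%N] xi)
    (hXxi : independent_processes setT [set n : nat | (0 < n)%N] X xi)
    (g : R -> R) (hg_density : has_density (xi 1%N) g) (hg : C2_bounded g)
    (pi_ : R -> nat -> Omega -> 'cV[R]_d)
    (hpi : forall sigma : R, 0 < sigma -> forall w : Omega,
      filtering_solution a h g Lam nu sigma
        (fun n => observation h X xi sigma n w) (fun n => pi_ sigma n w)) :
  forall n : nat, {ae P, forall w : Omega,
    (pi_ sigma n w @[sigma --> +oo] --> nu_seq Lam nu n) /\
    (sigma *: (pi_ sigma n w - nu_seq Lam nu n) @[sigma --> +oo] -->
       Z_seq a h g Lam nu (fun k => xi k w) n)}.
Proof.
have dg := C2_derivable1 hg.
have mg : measurable_fun setT g.
  apply: measurable_realfun.continuous_measurable_fun => t.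
  exact/differentiable_continuous/derivable1_diffP.
move=> n.
(* This event is chosen independently of [sigma], so the limit over the continuum of values of
   [sigma] can be taken outcome by outcome. *)
have : {ae P, forall w k, g (xi k.+1 w) != 0}.
  apply/ae_foralln => k; apply: (ae_density_neq0 mg hg_density).
  exact: hxi_id.
apply: filterS => w gx.
have [_ Zn] := filter_expansion (mc_stochastic hX) (mc_simplex hX)
  (proj1 hg_density) dg gx (fun s s0 => hpi s s0 w) n.
by split=> //; exact: cvg_scaled_mx Zn.
Qed.
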